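(* Let $1\le r\le n$, let $p=(p_1,\dots,p_n)$ be a size vector, let $A,B\subseteq S_p$ form a maximal pair of $r$-cross-intersecting families, and let $T$ be the set of coordinates that are relevant for $A$ or for $B$. Then $$|A|\le \frac{|S_p|}{\prod_{i\in T}(p_i-1)^{1-2/p_i}}\quad\text{and}\quad |B|\le \frac{|S_p|}{\prod_{i\in T}(p_i-1)^{1-2/p_i}}.$$
   Context: $[m]=\{1,\dots,m\}$. A size vector is a sequence of integers $p=(p_1,\dots,p_n)$ with $p_i\ge 2$ for all $i$; $S_p=[p_1]\times\cdots\times[p_n]$. Two vectors $x,y\in S_p$ are $r$-intersecting if $|\{i: x_i=y_i\}|\ge r$; families $A,B\subseteq S_p$ are $r$-cross-intersecting if every $x\in A$, $y\in B$ are $r$-intersecting. A pair $(A,B)$ of $r$-cross-intersecting families in $S_p$ is maximal if it maximizes $|A|\cdot|B|$ among all $r$-cross-intersecting pairs in $S_p$. A coordinate $i$ is irrelevant for $A\subseteq S_p$ if whenever two elements of $S_p$ differ only in coordinate $i$ and one lies in $A$, so does the other; otherwise $i$ is relevant for $A$. *)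

(* Defs.v *)
From mathcomp Require Import all_boot.
From Stdlib Require Import Reals.
Set Implicit Arguments. Unset Strict Implicit. Unset Printing Implicit Defensive.

Definition Sp (n : nat) (p : 'I_n -> nat) : finType :=
  {dffun forall i : 'I_n, 'I_(p i)}.

Definition agree n (p : 'I_n -> nat) (x y : Sp p) : nat :=
  #|[set i : 'I_n | x i == y i]|.

Definition r_cross_intersecting n (p : 'I_n -> nat) (r : nat)
  (A B : {set Sp p}) : Prop :=
  forall x y, x \in A -> y \in B -> r <= agree x y.

Definition maximal_pair n (p : 'I_n -> nat) (r : nat) (A B : {set Sp p}) : Prop :=
  r_cross_intersecting r A B /\
  forall A' B' : {set Sp p}, r_cross_intersecting r A' B' ->
    #|A'| * #|B'| <= #|A| * #|B|.

Definition irrelevant n (p : 'I_n -> nat) (i : 'I_n) (A : {set Sp p}) : Prop :=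
  forall x y : Sp p, (forall j, j != i -> x j = y j) -> x \in A -> y \in A.

Definition relevant n (p : 'I_n -> nat) (i : 'I_n) (A : {set Sp p}) : Prop :=
  ~ irrelevant i A.

(* Main.v *)
(* Write [a_l] and [b_l] for the proportions of elements with [x_i = l] in [A]
   and in [B]. For [l <> m] the sets [A_l * [p_i]] and [B_m * [p_i]] are again
   r-cross-intersecting, so maximality gives [a_l * b_m <= 1 / p_i ^ 2]. If [a_l]
   is the largest of all these proportions, summing over [m <> l] yields
   [a_l (1 - a_l) <= (1 / p_i) (1 - 1 / p_i)]: either all proportions equal
   [1 / p_i], and then [i] turns out to be irrelevant (or [p_i = 2]), or both [A]
   and [B] have at most a fraction [1 / p_i] of their elements off [x_i = l].
   The entropy of the [i]-th coordinate of a random element of [A] is then at most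
   [ln p_i - (1 - 2 / p_i) ln (p_i - 1)], and the entropies add up to at least
   [ln #|A|]; this is used through Gibbs' inequality against a product density. *)
From HB Require Import structures.
Require Import Defs.
From mathcomp Require Import all_boot zify.
From Stdlib Require Import Reals Lra Lia.
Set Implicit Arguments. Unset Strict Implicit. Unset Printing Implicit Defensive.

(** * Slices of a family along a coordinate *)

Definition upd n (p : 'I_n -> nat) (i : 'I_n) (l : 'I_(p i)) (x : Sp p) : Sp p :=
  [ffun j => dfwith x l j].

Lemma card_split (S : finType) (A : {set S}) (P : pred S) :
  #|A| = #|[set x in A | P x]| + #|[set x in A | ~~ P x]|.
Proof.
rewrite -(cardsID [set x | P x] A); congr addn.
  by apply: eq_card => x; rewrite !inE.
by apply: eq_card => x; rewrite !inE andbC.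
Qed.

Section Slices.
Variables (n : nat) (p : 'I_n -> nat).
Implicit Types (i : 'I_n) (A B : {set Sp p}).

Lemma updE i (l : 'I_(p i)) (x : Sp p) : upd l x i = l.
Proof. by rewrite ffunE dfwith_in. Qed.

Lemma upd_out i (l : 'I_(p i)) (x : Sp p) j : j != i -> upd l x j = x j.
Proof. by move=> ji; rewrite ffunE dfwith_out // eq_sym. Qed.

Lemma upd_eq i (x y : Sp p) : (forall j, j != i -> x j = y j) ->
  upd (y i) x = y.
Proof.
move=> xy; apply/ffunP => j; have [->|ji] := eqVneq j i; first by rewrite updE.
by rewrite upd_out // xy.
Qed.

(* [slice l A] is [A_l * [p_i]], where [A_l] is the set of the [x] in [A] with
   [x i = l], projected along coordinate [i]. *)
Definition slice i (l : 'I_(p i)) A : {set Sp p} := [set x | upd l x \in A].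

(** Sorting the slice by the value [m] at [i], each of the [p i] classes is the bijective image
    under [upd m] of the part of [A] with [x i = l]. *)
Lemma card_slice i (l : 'I_(p i)) A :
  #|slice l A| = p i * #|[set x in A | x i == l]|.
Proof.
rewrite -sum1_card (partition_big (fun x : Sp p => x i) predT) //=.
transitivity (\sum_(m < p i) #|[set x in A | x i == l]|); last first.
  by rewrite sum_nat_const card_ord.
apply: eq_bigr => m _.
rewrite sum1_card -(card_in_imset (f := upd m)) => [|x y].
  apply: eq_card => x; rewrite [LHS]inE /= inE; apply/andP/imsetP.
    move=> [Ax /eqP xm]; exists (upd l x); first by rewrite inE Ax updE eqxx.
    by rewrite -xm upd_eq // => j ji; rewrite upd_out.
  move=> [y]; rewrite inE => /andP[Ay /eqP <-] ->.
  by rewrite updE upd_eq // => j ji; rewrite upd_out.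
rewrite !inE => /andP[_ /eqP xl] /andP[_ /eqP yl] xy.
rewrite -[y](@upd_eq i x) ?yl -?xl; first by rewrite upd_eq.
by move=> j ji; rewrite -(upd_out m x ji) xy upd_out.
Qed.

Lemma card_sum i A : #|A| = \sum_(l < p i) #|[set x in A | x i == l]|.
Proof.
rewrite -sum1_card (partition_big (fun x : Sp p => x i) predT) //=.
by apply: eq_bigr => l _; rewrite sum1_card; apply: eq_card => x; rewrite !inE.
Qed.

(** * Cross-intersection and maximality at one coordinate *)

Lemma agreeC (x y : Sp p) : agree x y = agree y x.
Proof. by apply: eq_card => i; rewrite !inE eq_sym. Qed.

Lemma maximal_pairC r A B : maximal_pair r A B -> maximal_pair r B A.
Proof.
move=> [rAB mAB]; split=> [x y Bx Ay|A' B' rAB']; first by rewrite agreeC rAB.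
by rewrite mulnC [X in _ <= X]mulnC mAB // => x y Ax By; rewrite agreeC rAB'.
Qed.

(** The updated vectors disagree at [i], so all their agreements lie at other coordinates, where
    they still equal [x] and [y]. *)
Lemma slices_cross r A B i (l m : 'I_(p i)) x y : r_cross_intersecting r A B ->
  l != m -> x \in slice l A -> y \in slice m B -> r <= agree x y.
Proof.
rewrite !inE => rAB lm xA yB; apply: leq_trans (rAB _ _ xA yB) _.
apply: subset_leq_card; apply/subsetP => j; rewrite !inE.
by have [->|ji] := eqVneq j i; rewrite ?updE ?(negPf lm) // !upd_out.
Qed.

(** A singleton paired with itself has product [1], and [r <= n] makes it cross-intersecting. *)
Lemma maximal_card_gt0 r A B : (forall i, 0 < p i) -> r <= n ->
  maximal_pair r A B -> 0 < #|A| /\ 0 < #|B|.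
Proof.
move=> p0 rn [_ mAB]; apply/andP; rewrite -muln_gt0.
pose x : Sp p := [ffun i => Ordinal (p0 i)].
suff /mAB : r_cross_intersecting r [set x] [set x] by rewrite cards1.
move=> _ _ /set1P-> /set1P->; apply: leq_trans rn _.
by rewrite -[n in n <= _]card_ord; apply/subset_leq_card/subsetP => i; rewrite inE eqxx.
Qed.


(** The case [m = m'] bounds products of proportions; distinct [m] and [m'] serve the equality case,
    where slices must coincide. *)
Lemma slice_mulU r A B i (l m m' : 'I_(p i)) : maximal_pair r A B ->
  l != m -> l != m' ->
  #|slice l A| * #|slice m B :|: slice m' B| <= #|A| * #|B|.
Proof.
move=> [rAB mAB] lm lm'; apply: mAB => x y xA /setUP[] yB.
  exact: slices_cross rAB lm xA yB.
exact: slices_cross rAB lm' xA yB.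
Qed.

Lemma slice_irrelevant A i :
  (forall l m : 'I_(p i), slice l A = slice m A) -> irrelevant i A.
Proof.
move=> eqA x y xy xA; have: x \in slice (x i) A by rewrite inE upd_eq.
by rewrite (eqA _ (y i)) inE upd_eq.
Qed.

Lemma sum_slice A i : \sum_(l < p i) #|slice l A| = p i * #|A|.
Proof.
by rewrite (card_sum i A) big_distrr; apply: eq_bigr => l _; rewrite card_slice.
Qed.

Lemma sum_eq_bound N (F : 'I_N -> nat) c :
  (forall k, F k <= c) -> \sum_k F k = N * c -> forall k, F k = c.
Proof.
move=> Fc sF k; apply/eqP; rewrite eqn_leq Fc.
have: \sum_(j < N) c = N * c by rewrite sum_nat_const card_ord.
rewrite -sF (bigD1 k) //= [in X in _ = X](bigD1 k) //= => e.
have: \sum_(j < N | j != k) F j <= \sum_(j < N | j != k) c by exact: leq_sum.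
move: e; set s := \sum_(j < N | _) F j; set t := \sum_(j < N | _) c.
lia.
Qed.

(** As [p i > 2], there is a third value [k]. Pairing the slice of [A] at [k] with the union of the
    two slices of [B] shows that this union has at most [#|B|] elements, so each of the two fills
    it. *)
Lemma slices_eq r A B i (l m : 'I_(p i)) : maximal_pair r A B ->
  2 < p i -> 0 < #|A| -> (forall k : 'I_(p i), #|slice k A| = #|A|) ->
  (forall k : 'I_(p i), #|slice k B| = #|B|) -> slice l B = slice m B.
Proof.
move=> mAB p3 a0 sA sB.
have [k kl km]: exists2 k : 'I_(p i), k != l & k != m.
  suff /card_gt0P[k]: 0 < #|~: [set l; m]|.
    by rewrite !inE negb_or => /andP[]; exists k.
  by have := cardsC [set l; m]; rewrite card_ord cards2; case: (l != m) => /=; lia.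
have := slice_mulU mAB kl km; rewrite sA leq_pmul2l // => leU.
have eqU (j : 'I_(p i)) : slice j B \subset slice l B :|: slice m B ->
    slice j B = slice l B :|: slice m B.
  by move=> sub; apply/eqP; rewrite eqEcard sub sB.
by rewrite (eqU l (subsetUl _ _)) -(eqU m (subsetUr _ _)).
Qed.

(* With [x = al / a], the hypotheses give [x (1 - x) <= (1 / N) (1 - 1 / N)]. *)
Lemma concentration_arith N a b al ca bl cb :
  1 < N -> 0 < a -> 0 < b -> a = al + ca -> b = bl + cb -> a <= N * al ->
  bl * a <= al * b -> N * al * (N * cb) <= N.-1 * (a * b) ->
  (N * ca <= a /\ N * cb <= b) \/ (N * al = a /\ 2 < N).
Proof.
case: N => // K; rewrite /= => K0 a0 b0 ea eb ale hab hcb.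
(* From [bl / b <= al / a] comes [ca / a <= cb / b], which turns the mixed bound into one on [A]
   alone. *)
have hca : K.+1 * al * (K.+1 * ca) <= K * (a * a).
  rewrite -(leq_pmul2l b0).
  have h1 : b * ca <= a * cb by nia.
  have : K.+1 * al * K.+1 * (b * ca) <= K.+1 * al * K.+1 * (a * cb).
    by rewrite leq_mul2l h1 orbT.
  have : a * (K.+1 * al * (K.+1 * cb)) <= a * (K * (a * b)).
    by rewrite leq_mul2l hcb orbT.
  nia.
(* With [u = K.+1 * al], [hca] reads [(u - a) * (u - K * a) >= 0], so [u <= a] or [u >= K * a]. *)
have [le|lt] := leqP (K * a) (K.+1 * al).
  left; split; first by nia.
  have : K * a * (K.+1 * cb) <= K * a * b.
    apply: leq_trans (_ : K.+1 * al * (K.+1 * cb) <= _); last by rewrite -[K * a * b]mulnA.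
    by rewrite leq_mul2r le orbT.
  by rewrite leq_pmul2l // muln_gt0 a0 andbT.
right.
have e : K.+1 * al = a.
  set u := K.+1 * al in ale lt hca *.
  have eu : K.+1 * ca + u = a + K * a by rewrite /u ea; nia.
  nia.
split=> //; nia.
Qed.

Lemma concentrated_or_irrelevant r A B i (l : 'I_(p i)) : maximal_pair r A B ->
  1 < p i -> 0 < #|A| -> 0 < #|B| ->
  (forall k : 'I_(p i),
     #|[set x in A | x i == k]| <= #|[set x in A | x i == l]|) ->
  (forall m : 'I_(p i),
     #|[set x in B | x i == m]| * #|A| <= #|[set x in A | x i == l]| * #|B|) ->
  (p i * #|[set x in A | x i != l]| <= #|A| /\
   p i * #|[set x in B | x i != l]| <= #|B|) \/
  (irrelevant i A /\ irrelevant i B).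
Proof.
move=> mAB p2 a0 b0 maxA maxB.
have al_ge : #|A| <= p i * #|[set x in A | x i == l]|.
  have := leq_sum (index_enum 'I_(p i)) (P := predT) (fun k _ => maxA k).
  by rewrite sum_nat_const card_ord -card_sum.
have cbE : \sum_(m < p i | m != l) #|[set x in B | x i == m]| =
    #|[set x in B | x i != l]|.
  by have := card_split B (fun x => x i == l); rewrite {1}(card_sum i B) (bigD1 l) //= => /addnI.
have bound : p i * #|[set x in A | x i == l]| *
    (p i * #|[set x in B | x i != l]|) <= (p i).-1 * (#|A| * #|B|).
  have -> : (p i).-1 = #|[pred m : 'I_(p i) | m != l]|.
    by rewrite -[X in X.-1]card_ord (cardC1 l).
  rewrite -(sum_nat_const [pred m | m != l]) (eq_bigl (fun m => m != l)) // -cbE !big_distrr /=.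
  apply: leq_sum => m lm.
  by rewrite -!card_slice -[slice m B]setUid (slice_mulU mAB) // eq_sym.
have [|[eqA p3]] := concentration_arith p2 a0 b0 (card_split A _)
  (card_split B _) al_ge (maxB l) bound; first by left.
(* The largest slice of [A] has the average size [#|A|], so all slices have it; [maxB] then gives
   the same for [B]. *)
have sA : forall k : 'I_(p i), #|slice k A| = #|A|.
  apply: sum_eq_bound (sum_slice A i) => k.
  by rewrite card_slice -eqA leq_mul2l maxA orbT.
have sB : forall k : 'I_(p i), #|slice k B| = #|B|.
  apply: sum_eq_bound (sum_slice B i) => k.
  by rewrite card_slice -(leq_pmul2r a0) -mulnA -[X in _ <= _ * X]eqA; move: (maxB k); nia.
right; split; apply: slice_irrelevant => k m.
  exact: slices_eq (maximal_pairC mAB) p3 b0 sB sA.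
exact: slices_eq mAB p3 a0 sA sB.
Qed.

Lemma relevant_concentrated r A B i : (forall j, 1 < p j) -> r <= n ->
  maximal_pair r A B -> relevant i A \/ relevant i B ->
  exists l : 'I_(p i), p i * #|[set x in A | x i != l]| <= #|A| /\
                       p i * #|[set x in B | x i != l]| <= #|B|.
Proof.
move=> p2 rn mAB rel.
have [a0 b0] : 0 < #|A| /\ 0 < #|B|.
  by apply: maximal_card_gt0 mAB => // j; apply: ltnW.
have argmax (C : {set Sp p}) : exists l : 'I_(p i), forall k : 'I_(p i),
    #|[set x in C | x i == k]| <= #|[set x in C | x i == l]|.
  pose v0 : 'I_(p i) := Ordinal (ltnW (p2 i)).
  pose F (k : 'I_(p i)) := #|[set x in C | x i == k]|.
  by have [l _ maxl] := @arg_maxnP _ v0 predT F isT; exists l => k; apply: maxl.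
have [l maxl] := argmax A; have [m maxm] := argmax B.
(* The larger of the two maximal proportions plays the role of [a_l]; if it belongs to [B], the
   families are exchanged. *)
have [le|/ltnW le] := leqP (#|[set x in B | x i == m]| * #|A|)
    (#|[set x in A | x i == l]| * #|B|).
  have maxB k : #|[set x in B | x i == k]| * #|A| <=
      #|[set x in A | x i == l]| * #|B|.
    by apply: leq_trans le; rewrite leq_mul2r maxm ?orbT.
  have [h|] := concentrated_or_irrelevant mAB (p2 i) a0 b0 maxl maxB.
    by exists l.
  by case: rel => rel [].
have maxA k : #|[set x in A | x i == k]| * #|B| <=
    #|[set x in B | x i == m]| * #|A|.
  by apply: leq_trans le; rewrite leq_mul2r maxl ?orbT.
have [[hB hA]|] := concentrated_or_irrelevant (maximal_pairC mAB) (p2 i) b0 a0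
  maxm maxA; first by exists m.
by case: rel => rel [].
Qed.

End Slices.

(** * Finite sums and products of reals *)

HB.instance Definition _ := SemiGroup.isComLaw.Build R Rplus
  (fun x y z => esym (Rplus_assoc x y z)) Rplus_comm.
HB.instance Definition _ := Monoid.isMonoidLaw.Build R 0%R Rplus
  Rplus_0_l Rplus_0_r.
HB.instance Definition _ := SemiGroup.isComLaw.Build R Rmult
  (fun x y z => esym (Rmult_assoc x y z)) Rmult_comm.
HB.instance Definition _ := Monoid.isMonoidLaw.Build R 1%R Rmult
  Rmult_1_l Rmult_1_r.
HB.instance Definition _ := Monoid.isMulLaw.Build R 0%R Rmult
  Rmult_0_l Rmult_0_r.
HB.instance Definition _ := Monoid.isAddLaw.Build R Rmult Rplus
  (fun x y z => Rmult_plus_distr_r x y z)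
  (fun x y z => Rmult_plus_distr_l x y z).

Notation "\rsum_ ( i | P ) F" := (\big[Rplus/0%R]_(i | P%B) F)
  (at level 41, F at level 41, i at level 50).
Notation "\rsum_ ( i 'in' A ) F" := (\big[Rplus/0%R]_(i in A) F)
  (at level 41, F at level 41, i, A at level 50).
Notation "\rsum_ ( i : I ) F" := (\big[Rplus/0%R]_(i : I) F)
  (at level 41, F at level 41, i at level 50).
Notation "\rsum_ i F" := (\big[Rplus/0%R]_i F)
  (at level 41, F at level 41, i at level 0).
Notation "\rprod_ i F" := (\big[Rmult/1%R]_i F)
  (at level 36, F at level 36, i at level 0).

Section RealBigops.
Local Open Scope R_scope.

Lemma rsum_le (I : finType) (P : pred I) (F G : I -> R) :
  (forall i, P i -> F i <= G i) -> \rsum_(i | P i) F i <= \rsum_(i | P i) G i.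
Proof.
move=> FG; elim/big_rec2: _ => [|i x y Pi xy]; first exact: Rle_refl.
by apply: Rplus_le_compat => //; apply: FG.
Qed.

Lemma rsum_const (I : finType) (A : {pred I}) (c : R) :
  \rsum_(i in A) c = INR #|A| * c.
Proof.
rewrite big_const; elim: #|A| => [|m IH]; first by rewrite Rmult_0_l.
by rewrite iterS IH S_INR; lra.
Qed.

Lemma rprod_gt0 (I : finType) (F : I -> R) :
  (forall i, 0 < F i) -> 0 < \rprod_i F i.
Proof.
move=> F0; elim/big_rec: _ => [|i x _ x0]; first lra.
exact: Rmult_lt_0_compat.
Qed.

Lemma ln_rprod (I : finType) (F : I -> R) :
  (forall i, 0 < F i) -> ln (\rprod_i F i) = \rsum_i ln (F i).
Proof.
move=> F0.
suff [_ ->] : 0 < \rprod_i F i /\ ln (\rprod_i F i) = \rsum_i ln (F i) by [].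
elim/big_rec2: _ => [|i x y _ [y0 <-]]; first by split; [lra|exact: ln_1].
by split; [exact: Rmult_lt_0_compat|rewrite ln_mult].
Qed.

(** This makes a product of densities a density and, with all terms [1], computes [#|Sp p|]. *)
Lemma rprod_rsum_dffun (I : finType) (T : I -> finType)
    (q : forall i, T i -> R) :
  \rsum_(x : {dffun forall i, T i}) \rprod_i q i (x i) =
  \rprod_i \rsum_(v : T i) q i v.
Proof.
(* Passing to [fprod] leads to functions into a tagged union, where the ordinary distributive law
   applies; [untag] defaults to [0] at values with another tag. *)
rewrite (reindex _ (onW_bij predT (dffun_of_fprod_bij T))) /=.
transitivity (\rsum_(t : fprod T) \rprod_i [ffun v => q i v] (t i)).
  by apply: eq_bigr => t _; apply: eq_bigr => i _; rewrite !ffunE.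
rewrite big_fprod.
rewrite -(bigA_distr_big_dep (times := Rmult) _
  (fun i => untag 0 [ffun v => q i v])).
apply: eq_bigr => i _.
transitivity (\rsum_(v : T i) [ffun v => q i v] v).
  by rewrite (big_tag (fun i (v : T i) => [ffun v => q i v] v) i).
by apply: eq_bigr => v _; rewrite ffunE.
Qed.

(** * Gibbs' inequality and the entropy bound *)

Lemma ln_le_sub1 (t : R) : 0 < t -> ln t <= t - 1.
Proof. by move=> t0; have := exp_ineq1_le (ln t); rewrite exp_ln //; lra. Qed.

Lemma ln_div (x y : R) : 0 < x -> 0 < y -> ln (x / y) = ln x - ln y.
Proof.
move=> x0 y0; rewrite ln_mult ?ln_Rinv //; exact: Rinv_0_lt_compat.
Qed.

(** Sum [ln t <= t - 1] at [t = #|A| * w x] over [A]; the bound on the total weight makes the right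
    side at most [0]. *)
Lemma gibbs_card (S : finType) (A : {set S}) (w : S -> R) : (0 < #|A|)%nat ->
  (forall x, 0 < w x) -> \rsum_(x in A) w x <= 1 ->
  INR #|A| * ln (INR #|A|) <= \rsum_(x in A) - ln (w x).
Proof.
move=> A0 w0 w1; have N0 : 0 < INR #|A| by apply/lt_0_INR/ltP.
apply: (Rle_trans _ (\rsum_(x in A) ((ln (INR #|A|) + 1) + - INR #|A| * w x))).
  rewrite big_split /= rsum_const -big_distrr /=.
  move: (INR #|A|) (\rsum_(x in A) w x) N0 w1 => N s N0 s1; nra.
apply: rsum_le => x _; have w_gt0 := w0 x.
have := ln_le_sub1 (Rmult_lt_0_compat _ _ N0 w_gt0); rewrite ln_mult //; lra.
Qed.

(* The density on [N] values putting mass [1 - 1/N] on [l] and sharing the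
   remaining [1/N] equally. *)
Definition peak N (l v : 'I_N) : R :=
  if v == l then 1 - / INR N else / (INR N * (INR N - 1)).

Lemma INR_ge2 N : (1 < N)%nat -> 2 <= INR N.
Proof. by move=> /leP/le_INR. Qed.

Lemma peak_gt0 N (l v : 'I_N) : (1 < N)%nat -> 0 < peak l v.
Proof.
move=> /INR_ge2 N2; rewrite /peak; case: eqP => _.
  by have := Rinv_lt_contravar 1 (INR N) ltac:(lra) ltac:(lra); rewrite Rinv_1; lra.
by apply/Rinv_0_lt_compat/Rmult_lt_0_compat; lra.
Qed.

Lemma sum_peak N (l : 'I_N) : (1 < N)%nat -> \rsum_v peak l v = 1.
Proof.
move=> N1; have N2 := INR_ge2 N1.
rewrite (bigD1 l) //= /peak eqxx.
rewrite (eq_bigr (fun=> / (INR N * (INR N - 1)))); last by move=> v /negPf ->.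
have := rsum_const [pred v | v != l] (/ (INR N * (INR N - 1))).
rewrite (eq_bigl (fun v => v != l)) // => ->.
rewrite (cardC1 l) card_ord -subn1 minus_INR ?INR_1; last by apply/leP/ltnW.
by rewrite /=; field; lra.
Qed.

(** With [c] elements off [l], the sum is [#|A| * (ln N - ln (N - 1)) + 2 * c * ln (N - 1)], which
    is nondecreasing in [c], and [c <= #|A| / N]. *)
Lemma entropy_peak (S : finType) (A : {set S}) N (f : S -> 'I_N) (l : 'I_N) :
  (1 < N)%nat -> (N * #|[set x in A | f x != l]| <= #|A|)%nat ->
  \rsum_(x in A) - ln (peak l (f x)) <=
  INR #|A| * (ln (INR N) - (1 - 2 / INR N) * ln (INR N - 1)).
Proof.
move=> N1 hc; have N2 := INR_ge2 N1.
have pN : 0 < INR N * (INR N - 1) by apply: Rmult_lt_0_compat; lra.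
set c := #|[set x in A | f x != l]| in hc *.
set a := #|[set x in A | f x == l]|.
have cardA : #|A| = (a + c)%nat by apply: card_split.
have q1 : ln (1 - / INR N) = ln (INR N - 1) - ln (INR N).
  rewrite -ln_div; [|lra|lra]; congr ln; field; lra.
have q2 : ln (/ (INR N * (INR N - 1))) = - ln (INR N) - ln (INR N - 1).
  by rewrite ln_Rinv // ln_mult; lra.
have -> : \rsum_(x in A) - ln (peak l (f x)) =
    INR a * (ln (INR N) - ln (INR N - 1)) + INR c * (ln (INR N) + ln (INR N - 1)).
  rewrite (bigID (fun x => f x == l)) /=; congr Rplus.
    rewrite -rsum_const; apply: eq_big => x; first by rewrite inE.
    by move=> /andP[_ e]; rewrite /peak e q1; lra.
  rewrite -rsum_const; apply: eq_big => x; first by rewrite inE.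
  by move=> /andP[_ /negPf e]; rewrite /peak e q2; lra.
rewrite cardA plus_INR.
(* For [N = 2] the logarithm is [0], which strict monotonicity does not cover. *)
have L0 : 0 <= ln (INR N - 1).
  rewrite -ln_1; have [lt|<-] : 1 < INR N - 1 \/ 1 = INR N - 1 by lra.
    by apply/Rlt_le/ln_increasing; lra.
  exact: Rle_refl.
have hc' : INR c <= (INR a + INR c) / INR N.
  apply: (Rmult_le_reg_l (INR N)); first lra.
  have -> : INR N * ((INR a + INR c) / INR N) = INR a + INR c by field; lra.
  by have := le_INR _ _ (elimT leP hc); rewrite cardA plus_INR mult_INR.
have : 0 <= ((INR a + INR c) / INR N - INR c) * ln (INR N - 1).
  by apply: Rmult_le_pos; lra.
rewrite /Rdiv; move: (/ INR N) => t; nra.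
Qed.

Lemma entropy_uniform (S : finType) (A : {set S}) N : (0 < N)%nat ->
  \rsum_(x in A) - ln (/ INR N) = INR #|A| * ln (INR N).
Proof.
move=> /ltP/lt_0_INR N0.
by rewrite rsum_const ln_Rinv // Ropp_involutive.
Qed.

(** Gibbs' inequality is applied to the product density that is peaked at [l i] for [i] in [T] and
    uniform elsewhere. *)
Lemma card_le_of_concentrated n (p : 'I_n -> nat) (A : {set Sp p})
    (T : {set 'I_n}) (l : forall i, 'I_(p i)) : (forall i, 1 < p i)%nat ->
  (forall i, i \in T -> p i * #|[set x in A | x i != l i]| <= #|A|)%nat ->
  INR #|A| <= INR #|Sp p| /
    \big[Rmult/1]_(i in T) Rpower (INR (p i) - 1) (1 - 2 / INR (p i)).
Proof.
move=> p2 conc.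
have p_gt0 i : 0 < INR (p i) by have := INR_ge2 (p2 i); lra.
pose e i := (1 - 2 / INR (p i)) * ln (INR (p i) - 1).
(* [exp (e i)] is [Rpower] unfolded; the value [1] off [T] extends the product to all
   coordinates. *)
pose D i := if i \in T then exp (e i) else 1.
have D_gt0 i : 0 < D i by rewrite /D; case: ifP => _; [exact: exp_pos|lra].
have lnD i : ln (D i) = if i \in T then e i else 0.
  by rewrite /D; case: ifP => _; [exact: ln_exp|exact: ln_1].
rewrite (_ : \big[Rmult/1]_(i in T) _ = \rprod_i D i); last by rewrite big_mkcond.
have cardS : INR #|Sp p| = \rprod_i INR (p i).
  have -> : INR #|Sp p| = \rsum_(x : Sp p) \big[Rmult/1]_(i < n) 1.
    by rewrite -[LHS]Rmult_1_r -rsum_const; apply: eq_bigr => x _; rewrite big1.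
  rewrite (rprod_rsum_dffun (fun i (v : 'I_(p i)) => 1)).
  by apply: eq_bigr => i _; rewrite (rsum_const predT) card_ord Rmult_1_r.
have S_gt0 : 0 < INR #|Sp p| by rewrite cardS; apply: rprod_gt0.
have P_gt0 := rprod_gt0 D_gt0.
have bound_gt0 : 0 < INR #|Sp p| / \rprod_i D i by apply: Rdiv_lt_0_compat.
have [->|A_neq0] := eqVneq A set0; first by rewrite cards0; apply: Rlt_le.
have A_gt0 : (0 < #|A|)%nat by rewrite card_gt0.
have a_gt0 : 0 < INR #|A| by apply/lt_0_INR/ltP.
pose q i (v : 'I_(p i)) := if i \in T then peak (l i) v else / INR (p i).
have q_gt0 i v : 0 < q i v.
  by rewrite /q; case: ifP => _; [exact: peak_gt0|exact: Rinv_0_lt_compat].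
have sum_q i : \rsum_v q i v = 1.
  rewrite /q; case: (i \in T); first exact: sum_peak.
  transitivity (INR #|'I_(p i)| * / INR (p i)); first exact: (rsum_const predT).
  by rewrite card_ord; apply: Rinv_r; have := p_gt0 i; lra.
have w_gt0 (x : Sp p) : 0 < \rprod_i q i (x i) by apply: rprod_gt0.
have w_le1 : \rsum_(x in A) \rprod_i q i (x i) <= 1.
  have sum_w : \rsum_(x : Sp p) \rprod_i q i (x i) = 1.
    by rewrite rprod_rsum_dffun big1.
  rewrite -[X in _ <= X]sum_w [X in X <= _]big_mkcond; apply: rsum_le => x _.
  by case: ifP => _; [exact: Rle_refl|apply: Rlt_le].
apply: Rnot_lt_le => lt; move: (ln_increasing _ _ bound_gt0 lt); apply: Rle_not_lt.
apply: (Rmult_le_reg_l (INR #|A|)) => //.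
apply: Rle_trans (gibbs_card A_gt0 w_gt0 w_le1) _.
rewrite ln_div // cardS !ln_rprod //.
(* Both sides become sums over coordinates, to be compared term by term. *)
rewrite (_ : \rsum_(x in A) _ = \rsum_i \rsum_(x in A) - ln (q i (x i))); last first.
  rewrite exchange_big; apply: eq_bigr => x _; rewrite ln_rprod //.
  exact: (big_morph _ Ropp_plus_distr Ropp_0).
rewrite (_ : INR #|A| * _ =
    \rsum_i INR #|A| * (ln (INR (p i)) - ln (D i))); last first.
  rewrite -big_distrr big_split /=; congr (_ * (_ + _)).
  exact: (big_morph _ Ropp_plus_distr Ropp_0).
apply: rsum_le => i _; rewrite lnD /q; case: (boolP (i \in T)) => iT.
  exact: entropy_peak (p2 i) (conc i iT).
by rewrite entropy_uniform ?(ltnW (p2 i)) // Rminus_0_r; apply: Rle_refl.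
Qed.

End RealBigops.

Theorem theorem5 (n r : nat) (p : 'I_n -> nat)
  (hp : forall i, 2 <= p i) (hr1 : 1 <= r) (hrn : r <= n)
  (A B : {set Sp p}) (hmax : maximal_pair r A B)
  (T : {set 'I_n})
  (hT : forall i, i \in T <-> relevant i A \/ relevant i B) :
  let D := \big[Rmult/1%R]_(i in T)
             Rpower (INR (p i) - 1) (1 - 2 / INR (p i)) in
  (INR #|A| <= INR #|Sp p| / D)%R /\ (INR #|B| <= INR #|Sp p| / D)%R.
Proof.
pose conc (i : 'I_n) (v : 'I_(p i)) := i \in T ->
  p i * #|[set x in A | x i != v]| <= #|A| /\
  p i * #|[set x in B | x i != v]| <= #|B|.
(* For relevant [i] one value serves both families; outside [T] any value will do. *)
have [i|l lAB] := @fin_all_exists _ _ conc.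
  have [iT|niT] := boolP (i \in T); last first.
    by exists (Ordinal (ltnW (hp i))); rewrite /conc (negPf niT).
  have [v hv] := relevant_concentrated hp hrn hmax (proj1 (hT i) iT).
  by exists v.
split; apply: card_le_of_concentrated hp _ => i iT.
  exact: proj1 (lAB i iT).
exact: proj2 (lAB i iT).
Qed.
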